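(* Let $G$ be a graph. Then $$|V(G)|\leq \gamma_s(G^{\frac{1}{3}})\leq 2|E(G)|.$$
   Context: All graphs are finite and simple. For a graph $G=(V,E)$, a set $D\subseteq V$ is a dominating set if every vertex of $V\setminus D$ is adjacent to at least one vertex of $D$. A dominating set $D$ is a secure dominating set if for every $u\in V\setminus D$ there exists $v\in D$ with $uv\in E$ such that $(D\setminus\{v\})\cup\{u\}$ is a dominating set of $G$. The secure domination number $\gamma_s(G)$ is the minimum cardinality of a secure dominating set of $G$. For $k\in\mathbb{N}$, the $k$-subdivision $G^{\frac{1}{k}}$ is the graph obtained from $G$ by replacing each edge $v_iv_j$ of $G$ by a path of length $k$ (with $k-1$ new internal vertices) joining $v_i$ and $v_j$.
   Formalization: The upper bound is stated only for graphs G without isolated vertices, since it fails otherwise (for G = K_1, γ_s(G^{1/3}) = 1 > 0 = 2|E(G)|); the lower bound is stated for every graph G. *)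

(* Defs.v *)
From mathcomp Require Import all_boot.

Set Implicit Arguments.
Unset Strict Implicit.
Unset Printing Implicit Defensive.

Record sgraph := SGraph {
  svertex :> finType;
  sedge : rel svertex;
  sedge_sym : symmetric sedge;
  sedge_irr : irreflexive sedge }.

Section Domination.
Variable G : sgraph.

Definition edges : {set {set G}} :=
  [set [set p.1; p.2] | p in [set p : G * G | sedge p.1 p.2]].

Definition dominating (D : {set G}) : bool :=
  [forall u, (u \notin D) ==> [exists v in D, sedge u v]].

Definition secure_dominating (D : {set G}) : bool :=
  dominating D &&
  [forall u, (u \notin D) ==>
    [exists v in D, sedge u v && dominating (u |: (D :\ v))]].

Lemma secure_dominatingT : secure_dominating [set: G].
Proof.
by apply/andP; split; apply/forallP => u; rewrite in_setT.
Qed.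

(* [set: G] is a secure dominating set, so the minimum is over a nonempty
   family. *)
Definition secure_domination_number : nat :=
  #|[arg min_(D < [set: G] | secure_dominating D) #|D|]|.

End Domination.

Section Subdivision.
Variables (k : nat) (G : sgraph).

(* Each edge uv is represented once, by the pair (u, v) in which u precedes v
   in the enumeration of G: this orients the path that replaces it. *)
Definition oedge :=
  {p : G * G | sedge p.1 p.2 && (enum_rank p.1 < enum_rank p.2)}.

Lemma card_oedge : #|{: oedge}| = #|edges G|.
Proof.
pose f (p : oedge) : {set G} := [set (val p).1; (val p).2].
have f_inj : injective f.
  move=> [[a b] /= Hp] [[c d] /= Hq]; rewrite /f /= => E.
  apply: val_inj => /=.
  case/andP: Hp => /= _ ab; case/andP: Hq => /= _ cd.
  have /set2P ac : a \in [set c; d] by rewrite -E set21.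
  have /set2P bc : b \in [set c; d] by rewrite -E set22.
  case: ac bc ab => -> [] ->; rewrite ?ltnn //.
  by move/(ltn_trans cd); rewrite ltnn.
rewrite -(card_imset predT f_inj); congr #|pred_of_set _|.
apply/setP => e; apply/imsetP/imsetP => [[p _ ->]|[[a b]]].
  by exists (val p) => //; rewrite inE; case/andP: (valP p).
rewrite inE /= => ab ->.
have [lt|lt|E] := ltngtP (enum_rank a) (enum_rank b).
- have P : sedge (a, b).1 (a, b).2 && (enum_rank (a, b).1 < enum_rank (a, b).2).
    by rewrite /= ab.
  by exists (exist _ (a, b) P).
- have P : sedge (b, a).1 (b, a).2 && (enum_rank (b, a).1 < enum_rank (b, a).2).
    by rewrite /= sedge_sym ab.
  by exists (exist _ (b, a) P) => //; rewrite /f /= setUC.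
- by move/val_inj/enum_rank_inj: E ab => ->; rewrite sedge_irr.
Qed.

Definition sub_vertex : finType := (G + oedge * 'I_k.-1)%type.

(* The i-th vertex, 0 <= i <= k, of the path of length k that replaces e. *)
Definition path_vertex (e : oedge) (i : nat) : sub_vertex :=
  if i is j.+1 then
    if insub j is Some j' then inr (e, j') else inl (val e).2
  else inl (val e).1.

Definition sub_edge : rel sub_vertex := fun x y =>
  [exists e : oedge, exists i : 'I_k,
    ((x == path_vertex e i) && (y == path_vertex e i.+1))
    || ((y == path_vertex e i) && (x == path_vertex e i.+1))].

Lemma sub_edge_sym : symmetric sub_edge.
Proof.
by move=> x y; apply: eq_existsb => e; apply: eq_existsb => i; rewrite orbC.
Qed.

Lemma path_vertex_neq (e : oedge) (i : nat) :
  i < k -> path_vertex e i != path_vertex e i.+1.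
Proof.
move=> ik; apply/eqP; case: i ik => [|i] ik /=.
  case: insubP => //= _ [E]; case/andP: (valP e).
  by rewrite E sedge_irr.
case: insubP => [j1 _ v1|]; last by rewrite -ltnS prednK ?ik // (leq_trans _ ik).
case: insubP => [j2 _ v2|_ //] [] E.
by move: v2; rewrite -E /= v1 => /eqP; rewrite -[_ == _]/(i == i.+1) ltn_eqF.
Qed.

Lemma sub_edge_irr : irreflexive sub_edge.
Proof.
move=> x; apply/existsP => -[e /existsP[i]].
rewrite andbC orbb => /andP[/eqP E1 /eqP E2].
by have := path_vertex_neq e (ltn_ord i); rewrite -E1 -E2 eqxx.
Qed.

(* Meaningful for k >= 1; for k = 1 this is G itself, up to isomorphism. *)
Definition subdivision : sgraph := SGraph sub_edge_sym sub_edge_irr.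

End Subdivision.

(* Main.v *)
Require Import Defs.
From mathcomp Require Import all_boot.

(** The closed neighbourhoods of the original vertices partition the vertices
    of the 3-subdivision, so a dominating set meets each of these |V(G)|
    classes.  Conversely, without isolated vertices, the 2|E(G)| internal
    vertices dominate, and stay dominating when one of them is replaced by the
    original vertex of its class. *)

Section ThreeSubdivision.
Variable G : sgraph.
Notation H := (subdivision 3 G).

(* The unique original vertex at distance at most 1. *)
Definition center (x : H) : G :=
  match x with
  | inl v => v
  | inr (e, j) => if j == ord0 then (val e).1 else (val e).2
  end.

(** On a path of length 3 only the two end steps touch an original vertex; the middle step joins two
    internal vertices. *)
Lemma center_neighbor (v : G) (x : H) : sedge (inl v : H) x -> center x = v.
Proof.
have pv1 (e : oedge G) : path_vertex 3 e 1 = inr (e, ord0).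
  by rewrite /=; case: insubP => //= j _ vj; congr (inr (_, _)); apply: val_inj.
have pv2 (e : oedge G) : path_vertex 3 e 2 = inr (e, ord_max).
  by rewrite /=; case: insubP => //= j _ vj; congr (inr (_, _)); apply: val_inj.
have pv3 (e : oedge G) : path_vertex 3 e 3 = inl (val e).2.
  by rewrite /=; case: insubP.
move=> /existsP[e /existsP[[[|[|[|//]]] lti]]];
  rewrite ?pv1 ?pv2 ?pv3.
- by case/orP => /andP[/eqP E1 /eqP E2] //; case: E1 => ->; rewrite E2.
- by case/orP => /andP[/eqP E1 /eqP E2].
- by case/orP => /andP[/eqP E1 /eqP E2] //; case: E2 => ->; rewrite E1.
Qed.

Lemma center_edge (p : oedge G * 'I_2) :
  sedge (inl (center (inr p)) : H) (inr p).
Proof.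
case: p => e j /=; apply/existsP; exists e; apply/existsP.
case: j => [[|[|//]] ltj] /=.
- exists ord0; apply/orP; left; rewrite eqxx /=.
  by case: insubP => //= i _ vi; apply/eqP; congr (inr (_, _)); apply: val_inj.
- exists ord_max; apply/orP; right => /=.
  case: insubP => //= i _ vi; case: insubP => //= _; rewrite eqxx andbT.
  by apply/eqP; congr (inr (_, _)); apply: val_inj.
Qed.

(** [center] maps [D] onto [G]: a vertex outside [D] is the center of any neighbour that dominates
    it. *)
Lemma card_dominating_subdivision3 (D : {set H}) : dominating D -> #|G| <= #|D|.
Proof.
move=> /forallP domD; apply: leq_trans (leq_imset_card center D).
apply/subset_leq_card/subsetP => v _; apply/imsetP.
have [vD|vND] := boolP ((inl v : H) \in D); first by exists (inl v).
have /existsP[x /andP[xD vx]] := implyP (domD (inl v)) vND.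
by exists x => //; rewrite (center_neighbor _ _ vx).
Qed.

(** The path of an edge is oriented by [enum_rank], so the internal vertex next to [v] is the first
    or the second one, according to which endpoint has the smaller rank. *)
Lemma exists_internal_vertex (v w : G) : sedge v w ->
  exists p : oedge G * 'I_2, center (inr p) = v.
Proof.
move=> vw; have [lt|lt|E] := ltngtP (enum_rank v) (enum_rank w).
- have P : sedge (v, w).1 (v, w).2 && (enum_rank (v, w).1 < enum_rank (v, w).2).
    by rewrite /= vw.
  by exists (exist _ (v, w) P, ord0).
- have P : sedge (w, v).1 (w, v).2 && (enum_rank (w, v).1 < enum_rank (w, v).2).
    by rewrite /= sedge_sym vw.
  by exists (exist _ (w, v) P, ord_max).
- by move/val_inj/enum_rank_inj: E vw => ->; rewrite sedge_irr.
Qed.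

Definition internal_vertices : {set H} :=
  [set (inr p : H) | p in [set: oedge G * 'I_2]].

Lemma card_internal_vertices : #|internal_vertices| = 2 * #|edges G|.
Proof.
rewrite card_imset; last by move=> p q [].
by rewrite cardsT card_prod card_ord card_oedge mulnC.
Qed.

Lemma mem_internal_vertices (p : oedge G * 'I_2) :
  (inr p : H) \in internal_vertices.
Proof. exact: imset_f. Qed.

Lemma secure_dominating_internal_vertices :
  (forall v : G, exists w : G, sedge v w) ->
  secure_dominating internal_vertices.
Proof.
move=> noiso.
have inner v : exists p : oedge G * 'I_2, center (inr p) = v.
  by have [w vw] := noiso v; exact: exists_internal_vertex vw.
(* The same internal neighbour [inr p] of [inl v] serves for domination and for the exchange; only
   domination after the exchange remains. *)
apply/andP; split; apply/forallP => -[v|p]; apply/implyP;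
  rewrite ?mem_internal_vertices // => _; have [p pv] := inner v;
  apply/existsP; exists (inr p); rewrite mem_internal_vertices
  -{1}pv center_edge ?andTb //.
apply/forallP => z; apply/implyP => zN.
(* The removed vertex [inr p] is now dominated by [inl v]. *)
have [->|zp] := eqVneq z (inr p).
  by apply/existsP; exists (inl v); rewrite setU11 andTb sedge_sym -pv center_edge.
case: z zN zp => [x|q]; last first.
  by move=> zN zp; rewrite in_setU in_setD1 zp mem_internal_vertices orbT in zN.
(* An internal neighbour of [x] survives the exchange: its center [x] differs from the center [v] of
   [p]. *)
rewrite in_setU1 negb_or => /andP[xv _] _; have [q qx] := inner x.
apply/existsP; exists (inr q); rewrite -{1}qx center_edge andbT.
rewrite in_setU1 in_setD1 mem_internal_vertices andbT /=.
by apply: contraNneq xv => -[qp]; rewrite -qx qp pv.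
Qed.

End ThreeSubdivision.

(** The upper bound fails with isolated vertices: for a single vertex the secure domination number
    is 1, while there are no edges. *)
Theorem theorem2p6 (G : sgraph) :
  #|G| <= secure_domination_number (subdivision 3 G) /\
  ((forall x : G, exists y : G, sedge x y) ->
   secure_domination_number (subdivision 3 G) <= 2 * #|edges G|).
Proof.
rewrite /secure_domination_number.
case: arg_minnP => [|D /andP[domD _] minD]; first exact: secure_dominatingT.
split; first exact: card_dominating_subdivision3.
move=> noiso; rewrite -card_internal_vertices.
exact/minD/secure_dominating_internal_vertices.
Qed.
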